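(* Let $G$ be a connected graph (loops and multiple edges allowed) of maximum degree at most $\Delta$, all of whose nodes initially carry a third label ``blank'' distinguishable by the robot, and let $\langle r,d_1,d_2\rangle$ be an $\mathcal{AL}$ labeling of $G$. There is a labeling algorithm executed by a robot starting at $r$ and taking as input $\langle r,d_1,d_2\rangle$ (i.e. the parameters $d_1,d_2$) such that, by the end of its execution, every node of $G$ is colored black or white according to the $\mathcal{AL}$ labeling $\langle r,d_1,d_2\rangle$, and the robot has explored the entire graph and terminated at the root $r$.
   Context: Graph model: $G=(V,E)$ is an undirected connected anonymous graph (no node identifiers), possibly with loops and multiple edges; at each node $v$ the incident edge-ends are numbered by ports $0,\dots,\mathtt{deg}(v)-1$. $D$ is the diameter. A robot is a finite-memory mobile agent that sees the current node's degree and label and the port by which it entered, can change the label of the current node, and moves by choosing an exit port. $\mathcal{AL}$ labeling $\langle r,d_1,d_2\rangle$: $r$ is a chosen node (root); $d(u,v)$ is graph distance; integers $d_1\ge 2$, $d_2$ with $\lfloor d_2/2\rfloor\ge d_1$; let $q=d_1+d_2+2$. A node $v$ is black iff $d(r,v)\bmod q\in\{0,1,d_2+1,d_1+d_2+1\}$, and white otherwise. It is assumed that $D\ge d_1+d_2+1$. *)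

(* Defs.v *)
From mathcomp Require Import all_boot.
Set Implicit Arguments. Unset Strict Implicit. Unset Printing Implicit Defensive.

(* Nodes form a finite type [V]; [deg v] is the degree of [v]; for a port
   [p < deg v], [nbr v p = (u, q)] means that the edge-end numbered [p] at [v]
   is joined to the edge-end numbered [q] at [u].  Multiple edges and loops are
   allowed (a loop at [v] occupies two distinct ports of [v]). *)
Definition port_graph (V : finType) (deg : V -> nat) (nbr : V -> nat -> V * nat) : Prop :=
  forall v p, p < deg v ->
    [/\ (nbr v p).2 < deg (nbr v p).1,
        nbr (nbr v p).1 (nbr v p).2 = (v, p)
      & nbr v p <> (v, p)].

Definition adj (V : finType) (deg : V -> nat) (nbr : V -> nat -> V * nat) : rel V :=
  fun v u => [exists p : 'I_(deg v), (nbr v p).1 == u].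

Definition connected_graph (V : finType) deg (nbr : V -> nat -> V * nat) : Prop :=
  forall u v, connect (adj deg nbr) u v.

Fixpoint reachn (V : finType) deg (nbr : V -> nat -> V * nat) (k : nat) (u v : V) : bool :=
  match k with
  | 0 => u == v
  | k'.+1 => reachn deg nbr k' u v || [exists w, reachn deg nbr k' u w && adj deg nbr w v]
  end.

(* graph distance: least k (< #|V|) such that v is reachable from u within k steps
   (in a connected graph every distance is < #|V|). *)
Definition dist (V : finType) deg (nbr : V -> nat -> V * nat) (u v : V) : nat :=
  \big[minn/#|V|]_(k < #|V| | reachn deg nbr k u v) (k : nat).

Definition diameter (V : finType) deg (nbr : V -> nat -> V * nat) : nat :=
  \max_(u : V) \max_(v : V) dist deg nbr u v.

Inductive label := Blank | Black | White.

Definition AL_black (d1 d2 : nat) (k : nat) : bool :=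
  let q := d1 + d2 + 2 in
  [|| k %% q == 0, k %% q == 1, k %% q == d2 + 1 | k %% q == d1 + d2 + 1].

Definition AL_color (V : finType) deg (nbr : V -> nat -> V * nat) (r : V) (d1 d2 : nat)
  (v : V) : label :=
  if AL_black d1 d2 (dist deg nbr r v) then Black else White.

(* A robot with state space [S] (a finite type) has a transition function
   [delta s d l ip = (s', l', act)]: in state [s], at a node of degree [d]
   carrying label [l], having entered through port [ip] ([None] at the start),
   it goes to state [s'], rewrites the current node's label to [l'], and
   either terminates ([act = None]) or leaves through port [p] ([act = Some p]). *)
Definition transition (S : finType) :=
  S -> nat -> label -> option nat -> S * label * option nat.

Inductive status := Running | Halted | Crashed.

Record config (S : Type) (V : finType) := Config {
  st_status : status;
  st_state : S;
  st_node : V;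
  st_inport : option nat;
  st_labels : V -> label;
  st_visited : {set V} (* nodes visited so far, for V a finType *) }.
Arguments Config {S V}.

Definition step (S : finType) (V : finType) (deg : V -> nat) (nbr : V -> nat -> V * nat)
  (delta : transition S) (c : config S V) : config S V :=
  match st_status c with
  | Running =>
      let v := st_node c in
      let '(s', l', act) := delta (st_state c) (deg v) (st_labels c v) (st_inport c) in
      let lab' := fun w => if w == v then l' else st_labels c w in
      match act with
      | None => Config Halted s' v (st_inport c) lab' (st_visited c)
      | Some p =>
          if p < deg v then
            Config Running s' (nbr v p).1 (Some (nbr v p).2) lab'
                   ((nbr v p).1 |: st_visited c)
          else Config Crashed s' v (st_inport c) lab' (st_visited c)
      end
  | _ => c
  end.

Definition init_config (S : finType) (V : finType) (s0 : S) (r : V) : config S V :=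
  Config Running s0 r None (fun _ => Blank) [set r].

Definition run (S : finType) (V : finType) deg (nbr : V -> nat -> V * nat)
  (delta : transition S) (s0 : S) (r : V) (n : nat) : config S V :=
  iter n (step deg nbr delta) (init_config s0 r).

(* Main.v *)
Require Import Defs.
From HB Require Import structures.
From mathcomp Require Import all_boot zify.

Set Implicit Arguments.
Unset Strict Implicit.
Unset Printing Implicit Defensive.

(** Breadth-first labelling by a finite automaton.  In stage [k] the layers at
    distance at most [k] from [r] are labelled and the robot walks depth first
    through the tree in which the parent of a node is reached by its smallest
    port leading one layer down, colouring the blank neighbours of layer [k].  It
    stops after a stage that colours nothing.  The robot only remembers [k] and
    its own layer modulo [q = d1 + d2 + 2]; with these, the labels in a bounded
    neighbourhood tell which neighbours lie one layer down.  Layers with residues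
    1 and [d2 + 1] bound a run of white layers that is at least twice as long as
    the run between [d2 + 1] and [q - 1], so only the former contains nodes at
    distance at least [d1] from every black node, and this fixes the orientation.  The
    labels cannot tell the root from a leaf of layer 1, so the port leading back
    to the root is remembered throughout the visit of a branch. *)

(** * Robot programs and their compilation into a finite automaton *)

Definition label_code (l : label) : option bool :=
  match l with Blank => None | Black => Some true | White => Some false end.
Definition label_decode (c : option bool) : label :=
  match c with None => Blank | Some true => Black | Some false => White end.
Lemma label_codeK : cancel label_code label_decode.
Proof. by case. Qed.
HB.instance Definition _ := Finite.copy label (can_type label_codeK).

(* [Jump p h] leaves through port [p] and restarts with the program of control
   state [h]; [Look] passes the degree, the label and the entry port (0 if none). *)
Inductive prog (H : Type) :=
  | Halt
  | Look of (nat -> label -> nat -> prog H)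
  | Write of label & prog H
  | Move of nat & prog H
  | Jump of nat & H.
Arguments Halt {H}.
Arguments Jump {H}.

(* What the robot does before leaving the current node. *)
Fixpoint settle H (P : prog H) (d : nat) (l : label) (i : nat) :
    label * option (nat * (prog H + H)) :=
  match P with
  | Halt => (l, None)
  | Look k => settle (k d l i) d l i
  | Write l' P' => settle P' d l' i
  | Move p P' => (l, Some (p, inl P'))
  | Jump p h => (l, Some (p, inr h))
  end.

Section Compile.
Variables (Delta : nat) (H : finType) (main : H -> prog H).

Definition obs : finType := ('I_Delta.+1 * label * 'I_Delta.+1)%type.

(** Maximizing over all observations possible under the degree bound gives a uniform limit on the
    history that the automaton must store. *)
Fixpoint depth (P : prog H) : nat :=
  match P with
  | Look k => \max_(o : obs) depth (k o.1.1 o.1.2 o.2)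
  | Write _ P' => depth P'
  | Move _ P' => (depth P').+1
  | _ => 0
  end.

Lemma depth_settle P d l i l' p P' : d <= Delta -> i <= Delta ->
  settle P d l i = (l', Some (p, inl P')) -> depth P' < depth P.
Proof.
move=> hd hi; elim: P l => [|k IH|l1 P IH|p1 P IH|p1 h] l //=.
- move=> /IH/leq_trans h; apply: h.
  have := @leq_bigmax _ (fun o : obs => depth (k o.1.1 o.1.2 o.2))
    (inord d, l, inord i).
  by rewrite /= !inordK.
- exact: IH.
- by case=> _ _ ->.
Qed.

Definition advance (P : prog H) (o : obs) : prog H :=
  if (settle P o.1.1 o.1.2 o.2).2 is Some (_, inl P') then P' else P.

Definition replay (h : H) (s : seq obs) : prog H := foldl advance (main h) s.

Definition budget : nat := \max_h depth (main h).

(* The robot stores its control state and its observations since the last [Jump];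
   replaying them yields the program that remains to be executed. *)
Definition rstate : finType := (H * {bseq budget of obs})%type.

Definition compile : transition rstate := fun s d l ip =>
  let i := odflt 0 ip in
  let '(l', a) := settle (replay s.1 s.2) d l i in
  match a with
  | None => (s, l', None)
  | Some (p, inl _) =>
      ((s.1, insub_bseq budget (rcons s.2 (inord d, l, inord i))), l', Some p)
  | Some (p, inr h) => ((h, [bseq]), l', Some p)
  end.

Section Run.
Variables (V : finType) (deg : V -> nat) (nbr : V -> nat -> V * nat).
Hypothesis graphP : port_graph deg nbr.
Hypothesis degD : forall v, deg v <= Delta.
Variables (r : V) (goal : V -> label).

Definition upd (lab : V -> label) (v : V) (l : label) : V -> label :=
  fun w => if w == v then l else lab w.

(* [good P v i lab]: executing [P] at [v], entered through [i], under the labels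
   [lab] halts at [r] with the labels [goal]. *)
Inductive good : prog H -> V -> nat -> (V -> label) -> Prop :=
  | GHalt i lab : lab =1 goal -> good Halt r i lab
  | GLook k v i lab : good (k (deg v) (lab v) i) v i lab -> good (Look k) v i lab
  | GWrite l P v i lab : good P v i (upd lab v l) -> good (Write l P) v i lab
  | GMove p P v i lab : p < deg v ->
      good P (nbr v p).1 (nbr v p).2 lab -> good (Move p P) v i lab
  | GJump p h v i lab : p < deg v ->
      good (main h) (nbr v p).1 (nbr v p).2 lab -> good (Jump p h) v i lab.

(** Looking and writing take no robot step of their own, so the stored program and the actual labels
    may lag behind [P] and [lab], but only at the current node and with the same [settle] outcome.
    The last premise keeps the history within its bounded sequence. *)
Lemma good_halts P v i lab : good P v i lab ->
  forall (s : rstate) ip lab0 vis, odflt 0 ip = i -> i <= Delta ->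
  settle (replay s.1 s.2) (deg v) (lab0 v) i = settle P (deg v) (lab v) i ->
  (forall w, w != v -> lab0 w = lab w) ->
  size s.2 + depth (replay s.1 s.2) <= budget ->
  exists n, let c := iter n (step deg nbr compile) (Config Running s v ip lab0 vis) in
    [/\ st_status c = Halted, st_node c = r & st_labels c =1 goal].
Proof.
elim=> {P v i lab}.
- move=> i lab labE [h s] ip lab0 vis ei hi /= es el _.
  exists 1; rewrite /= /step /= /compile /= ei es /=; split=> // w /=.
  by case: eqP => [->|/eqP/el->]; rewrite labE.
- by move=> k v i lab _ IH s ip lab0 vis ei hi es el hb; apply: IH.
- move=> l P v i lab _ IH s ip lab0 vis ei hi es el hb; apply: IH => //.
    by rewrite /upd eqxx.
  by move=> w wv; rewrite /upd (negPf wv) el.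
- move=> p P v i lab pv _ IH [h h'] ip lab0 vis ei hi /= es el hb.
  have hd := depth_settle (degD v) hi es.
  pose o : obs := (inord (deg v), lab0 v, inord i).
  have hs : size (rcons h' o) <= budget.
    by rewrite size_rcons (leq_trans _ hb) // -addn1 leq_add // (leq_trans _ hd).
  have hr : replay h (rcons h' o) = P.
    rewrite /replay -cats1 foldl_cat /= -/(replay h h') /advance /o /=.
    by rewrite !inordK ?ltnS // es.
  have he : insub_bseq budget (rcons h' o) = rcons h' o :> seq obs.
    by rewrite /insub_bseq insubdK.
  case: (IH (h, insub_bseq budget (rcons h' o)) (Some (nbr v p).2)
     (fun w => if w == v then lab v else lab0 w) ((nbr v p).1 |: vis) erefl);
    rewrite /= ?he ?hr.
  + have [h1 _ _] := graphP pv; have := degD (nbr v p).1; lia.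
  + by case: eqP => [->//|/eqP/el ->].
  + by move=> w _; case: eqP => [->//|/eqP/el ->].
  + by rewrite size_rcons addSnnS (leq_trans _ hb) ?leq_add2l.
  move=> n hn; exists n.+1; rewrite iterSr.
  by rewrite [X in iter n _ X]/step /= /compile /= ei es /= pv.
- move=> p h' v i lab pv _ IH [h s] ip lab0 vis ei hi /= es el hb.
  case: (IH (h', [bseq]) (Some (nbr v p).2)
     (fun w => if w == v then lab v else lab0 w) ((nbr v p).1 |: vis) erefl) => /=.
  + have [h1 _ _] := graphP pv; have := degD (nbr v p).1; lia.
  + by case: eqP => [->//|/eqP/el ->].
  + by move=> w _; case: eqP => [->//|/eqP/el ->].
  + exact: (leq_bigmax h').
  move=> n hn; exists n.+1; rewrite iterSr.
  by rewrite [X in iter n _ X]/step /= /compile /= ei es /= pv.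
Qed.

(** Only the current node is relabelled, and it has been visited. As goal labels are never blank, a
    complete colouring thus implies exploration. *)
Lemma visited_inv (s0 : rstate) n : let c := run deg nbr compile s0 r n in
  st_node c \in st_visited c /\
  (forall w, w \notin st_visited c -> st_labels c w = Blank).
Proof.
elim: n => [|n [IH1 IH2]]; first by rewrite /= set11.
rewrite /run iterS -/(run _ _ _ _ _ _); move: (run _ _ _ _ _ _) IH1 IH2 => c IH1 IH2.
rewrite /step; case: (st_status c) => //=.
have upd_blank l w : w \notin st_visited c ->
    (if w == st_node c then l else st_labels c w) = Blank.
  by move=> hw; case: eqP => [E|_]; [rewrite E IH1 in hw | exact: IH2].
case: (compile _ _ _ _) => [[s' l'] [p|]] /=; last by split=> // w /upd_blank.
case: ifP => _ /=; last by split=> // w /upd_blank.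
rewrite setU11; split=> // w; rewrite in_setU1 negb_or => /andP[_].
exact: upd_blank.
Qed.

Lemma compile_correct h0 : good (main h0) r 0 (fun=> Blank) ->
  (forall w, goal w != Blank) ->
  exists n, let c := run deg nbr compile (h0, [bseq]) r n in
    [/\ st_status c = Halted, st_node c = r, st_visited c = [set: V]
      & forall v, st_labels c v = goal v].
Proof.
move=> /good_halts-/(_ (h0, [bseq]) None (fun=> Blank) [set r] erefl) [] //=.
  exact: (leq_bigmax h0).
move=> n [h1 h2 h3] gB; exists n; split=> //.
apply/setP => w; rewrite inE; apply/negP => /negP hw.
have [_ /(_ w hw)] := visited_inv (h0, [bseq]) n.
by rewrite h3 => /eqP; apply/negP.
Qed.

End Run.
End Compile.

(** * Modal formulas and their evaluation by local walks *)

(* Modal formulas on nodes: [FDia f] holds where some neighbour satisfies [f]. *)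
Inductive form :=
  | FLab of label
  | FNot of form
  | FAnd of form & form
  | FOr of form & form
  | FDia of form.

Section Semantics.
Variables (V : finType) (deg : V -> nat) (nbr : V -> nat -> V * nat).

Definition first_port (a : pred V) (v : V) : option nat :=
  ohead [seq p <- iota 0 (deg v) | a (nbr v p).1].

Fixpoint eval (lab : V -> label) (f : form) : pred V := fun v =>
  match f with
  | FLab l => lab v == l
  | FNot f => ~~ eval lab f v
  | FAnd f g => eval lab f v && eval lab g v
  | FOr f g => eval lab f v || eval lab g v
  | FDia f => isSome (first_port (eval lab f) v)
  end.

Variant first_port_spec (a : pred V) (v : V) : option nat -> Prop :=
  | FirstSome p of p < deg v & a (nbr v p).1 : first_port_spec a v (Some p)
  | FirstNone of (forall p, p < deg v -> ~~ a (nbr v p).1) :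
      first_port_spec a v None.

Lemma first_portP a v : first_port_spec a v (first_port a v).
Proof.
rewrite /first_port; case E: [seq p <- _ | _] => [|p s] /=.
  constructor=> p pv; apply/negP => ap.
  have : p \in [seq p <- iota 0 (deg v) | a (nbr v p).1].
    by rewrite mem_filter ap mem_iota.
  by rewrite E.
have : p \in [seq p <- iota 0 (deg v) | a (nbr v p).1] by rewrite E mem_head.
by rewrite mem_filter mem_iota add0n => /andP[ap pv]; constructor.
Qed.

Lemma eq_first_port a b v :
  (forall p, p < deg v -> a (nbr v p).1 = b (nbr v p).1) ->
  first_port a v = first_port b v.
Proof.
move=> ab; congr ohead; apply: eq_in_filter => p.
by rewrite mem_iota add0n => /ab.
Qed.

Lemma evalDiaP lab f v :
  reflect (exists2 p, p < deg v & eval lab f (nbr v p).1) (eval lab (FDia f) v).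
Proof.
apply: (iffP idP) => /=; case: first_portP => //.
  by move=> p pv fp _; exists p.
by move=> h [p /h /negPf->].
Qed.
End Semantics.

Section Queries.
Variable H : Type.

(** [c] runs at the neighbour and must resume its continuation there; the closure keeps the entry
    port [i] for the way back. *)
Definition search (c : (bool -> prog H) -> prog H) (k : option nat -> prog H) :=
  Look (fun d _ _ => foldr (fun p K =>
    Move p (Look (fun _ _ i => c (fun b => Move i (if b then k (Some p) else K)))))
    (k None) (iota 0 d)).

Fixpoint chk (f : form) (k : bool -> prog H) : prog H :=
  match f with
  | FLab l => Look (fun _ l' _ => k (l' == l))
  | FNot f => chk f (fun b => k (~~ b))
  | FAnd f g => chk f (fun b => chk g (fun b' => k (b && b')))
  | FOr f g => chk f (fun b => chk g (fun b' => k (b || b')))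
  | FDia f => search (chk f) (fun o => k (isSome o))
  end.
End Queries.

Section QueriesCorrect.
Variables (H : finType) (main : H -> prog H).
Variables (V : finType) (deg : V -> nat) (nbr : V -> nat -> V * nat).
Hypothesis graphP : port_graph deg nbr.
Variables (r : V) (goal : V -> label).
Local Notation good := (good main deg nbr r goal).

Lemma good_search c k (a : pred V) v lab :
  (forall u i k', (forall i', good (k' (a u)) u i' lab) -> good (c k') u i lab) ->
  (forall i, good (k (first_port deg nbr a v)) v i lab) ->
  forall i, good (search c k) v i lab.
Proof.
move=> hc; rewrite /first_port => hk i; apply: GLook.
have: all (fun p => p < deg v) (iota 0 (deg v)).
  by apply/allP => p; rewrite mem_iota.
elim: (iota _ _) hk i => [|p s IH] hk i /=; first by move=> _; apply: hk.
case/andP=> pv sv; have [pv1 pv2 _] := graphP pv.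
apply: GMove => //; apply: GLook; apply: hc => i'; apply: GMove => //.
rewrite pv2 /=; move: hk => /=; case: (a _) => /= hk; first exact: hk.
exact: IH.
Qed.

Lemma good_chk f k v i lab :
  (forall i', good (k (eval deg nbr lab f v)) v i' lab) -> good (chk f k) v i lab.
Proof.
elim: f k v i => [l|f IH|f IH g IHg|f IH g IHg|f IH] k v i hk /=.
- by apply: GLook; apply: hk.
- exact: IH.
- by apply: IH => i'; apply: IHg.
- by apply: IH => i'; apply: IHg.
- by apply: good_search hk i => u i k' /IH.
Qed.
End QueriesCorrect.

(** * Decoding the layer below from the labels *)

Section Decode.
Variables (d1 d2 : nat).
Hypotheses (d1_ge2 : 2 <= d1) (d12 : d1 <= d2./2).
Let q := d1 + d2 + 2.

Definition color (m : nat) : label := if AL_black d1 d2 m then Black else White.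

(* The next formulas are meant for nodes with particular residues of their layer
   modulo [q]: [is_zero] for 0, [is_low] for 1 (it fails at [d2 + 1]), [is_last] for
   [q - 1] (it fails at 0 and 1), [is_mid] for [d2 + 1] (it fails at [q - 1]);
   [is_deep] holds at residue [d1 + 1], and nowhere between [d2 + 1] and [q - 1]. *)
Definition is_zero := FAnd (FLab Black) (FNot (FDia (FLab White))).
Definition is_low := FAnd (FLab Black) (FOr is_zero (FDia is_zero)).
Fixpoint wwalk (n : nat) (f : form) : form :=
  if n is n'.+1 then FAnd (FLab White) (FDia (wwalk n' f)) else f.
Fixpoint near_black (n : nat) : form :=
  if n is n'.+1 then FOr (near_black n') (FDia (near_black n')) else FLab Black.
Definition not_low := FAnd (FLab Black) (FNot is_low).
Definition is_last := FAnd (FLab Black) (FDia (wwalk (d1 - 1) not_low)).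
Definition is_deep := FAnd (FLab White) (FNot (near_black (d1 - 1))).
Definition to_deep := wwalk (d2 - d1 - 1) is_deep.
Definition is_mid := FAnd (FLab Black) (FDia to_deep).

(* For a node whose layer has residue [l], the neighbours satisfying [lower l] are
   those one layer down, except that the root never satisfies [lower 1]. *)
Definition lower (l : nat) : form :=
  if l == 0 then is_last
  else if l == 1 then FAnd is_zero (FDia is_last)
  else if l <= d2 then wwalk (l - 2) is_low
  else if l == d2 + 1 then to_deep
  else if l == d1 + d2 + 1 then FLab White
  else wwalk (l - d2 - 2) is_mid.

(* The neighbours one layer up: either the label shows that the layer differs, or
   they have no neighbour one layer below the current one. *)
Definition child (l : nat) : form :=
  let f := FAnd (FLab (color l.+1)) (FNot (lower l)) in
  if color l == color l.+1 then FAnd f (FNot (FDia (lower l))) else f.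

Variables (V : finType) (deg : V -> nat) (nbr : V -> nat -> V * nat).
Variables (r : V) (d : V -> nat).
Hypothesis d0 : forall v, (d v == 0) = (v == r).
Hypothesis d_nbr : forall v p, p < deg v ->
  d (nbr v p).1 <= (d v).+1 /\ d v <= (d (nbr v p).1).+1.
Hypothesis d_down : forall v, 0 < d v ->
  exists2 p, p < deg v & (d (nbr v p).1).+1 = d v.

(** Suited to the middle of a stage: the outermost labelled layer may be incomplete, but a descent
    from a labelled node meets only labelled nodes. *)
Definition labeled_below (lab : V -> label) : Prop :=
  forall v, lab v != Blank ->
    lab v = color (d v) /\ forall w, d w < d v -> lab w != Blank.

Variable lab : V -> label.
Hypothesis labP : labeled_below lab.
Local Notation ev := (eval deg nbr lab).
Local Notation diaP f := (evalDiaP deg nbr lab f).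
Definition off (v : V) : nat := d v %% q.

Lemma offS m : m.+1 %% q = if (m %% q).+1 == q then 0 else (m %% q).+1.
Proof.
rewrite {1}(divn_eq m q) -addnS modnMDl; case: eqP => [->|hq]; first exact: modnn.
by rewrite modn_small //; have := @ltn_pmod m q; lia.
Qed.

Lemma off_lt v : off v < d1 + d2 + 2.
Proof. by rewrite ltn_mod; lia. Qed.

Lemma off_nbr v p : p < deg v -> let u := (nbr v p).1 in
  off u = off v \/ off u = (off v).+1 \/ off v = (off u).+1 \/
  (off v = d1 + d2 + 1 /\ off u = 0) \/ (off v = 0 /\ off u = d1 + d2 + 1).
Proof.
move=> /d_nbr; rewrite /= /off; move: (d _) (d v) => a b [h1 h2].
have [->|ne] := eqVneq a b; first by left.
have [->|ne'] := eqVneq a b.+1; first by rewrite offS /q; case: eqP; lia.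
by have -> : b = a.+1; [lia | rewrite offS /q; case: eqP; lia].
Qed.

Lemma off_down v : lab v != Blank -> 0 < d v -> exists p,
  let u := (nbr v p).1 in
  [/\ p < deg v, (d u).+1 = d v, lab u != Blank
    & off v = if (off u).+1 == q then 0 else (off u).+1].
Proof.
move=> lv /d_down[p pv e]; exists p; split=> //; last by rewrite -/off -offS e.
by have [_ h] := labP lv; apply: h; rewrite -e.
Qed.

Lemma colorE m : color m = if let x := m %% q in
  [|| x == 0, x == 1, x == d2 + 1 | x == d1 + d2 + 1] then Black else White.
Proof. by []. Qed.

Lemma blackE v : lab v == Black ->
  off v = 0 \/ off v = 1 \/ off v = d2 + 1 \/ off v = d1 + d2 + 1.
Proof.
move=> /eqP lv; have [|] := @labP v; first by rewrite lv.
rewrite lv colorE -/(off v) => + _; case: ifP => //=; lia.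
Qed.

Lemma whiteE v : lab v == White ->
  (2 <= off v <= d2) || (d2 + 2 <= off v <= d1 + d2).
Proof.
move=> /eqP lv; have [|] := @labP v; first by rewrite lv.
rewrite lv colorE -/(off v) => + _; case: ifP => //= /negbT.
by have := off_lt v; rewrite /q; lia.
Qed.

Lemma labelE v : lab v != Blank -> lab v =
  if [|| off v == 0, off v == 1, off v == d2 + 1 | off v == d1 + d2 + 1]
  then Black else White.
Proof. by move=> /labP[-> _]. Qed.

Lemma off_down_pos v : lab v != Blank -> 0 < off v -> exists p,
  [/\ p < deg v, lab (nbr v p).1 != Blank & off v = (off (nbr v p).1).+1].
Proof.
move=> lv ov; have dv : 0 < d v.
  by move: ov; rewrite /off; case: (d v) => //; rewrite mod0n.
have [p [pv _ lu ou]] := off_down lv dv; exists p; split=> //.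
by move: ou ov => ->; case: ifP.
Qed.

Lemma wwalk_down n f a v : lab v != Blank -> off v = a + n ->
  (0 < a /\ a + n <= d2) \/ (d2 < a /\ a + n <= d1 + d2) ->
  (forall x, lab x != Blank -> off x = a -> ev f x) -> ev (wwalk n f) v.
Proof.
move=> + + hb hf; elim: n v hb => [|n IH] v hb lv ov.
  by apply: hf => //; rewrite ov addn0.
have ovq := off_lt v.
apply/andP; split.
  rewrite /= labelE // ov; case: ifP => //; lia.
have [|p [pv lu ou]] := off_down_pos lv; first by lia.
apply/(diaP (wwalk n f)); exists p => //; apply: IH => //; lia.
Qed.

Lemma zero_at v : lab v != Blank -> off v = 0 -> ev is_zero v.
Proof.
move=> lv ov; rewrite /is_zero; apply/andP; split; first by rewrite /= labelE // ov.
apply/negP => /(diaP (FLab White))[p /off_nbr /= h /whiteE w].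
by lia.
Qed.

Lemma low_at1 v : lab v != Blank -> off v = 1 -> ev is_low v.
Proof.
move=> lv ov; apply/andP; split; first by rewrite /= labelE // ov.
apply/orP; right; have [|p [pv lu ou]] := off_down_pos lv; first by rewrite ov.
apply/(diaP is_zero); exists p => //; apply: zero_at => //; lia.
Qed.

Lemma mid_nonzero v : off v = d2 + 1 -> ~~ ev is_zero v.
Proof.
move=> ov; apply/negP => /andP[/= /eqP bv] /negP; apply.
have lv : lab v != Blank by rewrite bv.
have [|p [pv lu ou]] := off_down_pos lv; first by lia.
apply/(diaP (FLab White)); exists p => //=; rewrite labelE //.
case: ifP => //; lia.
Qed.

(** Black neighbours also have residue [d2 + 1], and such nodes have a white neighbour one layer
    down, so none satisfies [is_zero]. *)
Lemma mid_not_low v : off v = d2 + 1 -> ~~ ev is_low v.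
Proof.
move=> ov; apply/negP => /andP[_ /orP[|/(diaP is_zero)[p /off_nbr /= h z]]].
  by apply/negP/mid_nonzero.
have /andP[/blackE b _] := z; move: z; apply/negP/mid_nonzero; lia.
Qed.

Lemma off_nbr_white v p : p < deg v -> lab v == White ->
  (off v).-1 <= off (nbr v p).1 <= (off v).+1.
Proof. by move=> /off_nbr /= h /whiteE w; lia. Qed.

(** White steps change the residue by at most one, so [n] of them cannot get down to 1; the walk can
    meet black only at [d2 + 1], where [is_low] fails. *)
Lemma wwalk_low_false n v : n + 2 <= off v <= d2 + 1 -> ~~ ev (wwalk n is_low) v.
Proof.
elim: n v => [|n IH] v ov; apply/negP.
  move=> /[dup] /andP[/blackE b _]; apply/negP/mid_not_low; lia.
case/andP=> [wv /(diaP (wwalk n is_low))[p pv]]; apply/negP/IH.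
by have := off_nbr_white pv wv; have := whiteE wv; lia.
Qed.

Lemma near_false n v : n + 2 <= off v -> off v + n <= d2 -> ~~ ev (near_black n) v.
Proof.
elim: n v => [|n IH] v ov ov'; apply/negP.
  by move/blackE; lia.
case/orP => [|/(diaP (near_black n))[p /off_nbr h]]; first by apply/negP/IH; lia.
by apply/negP/IH; move: h => /=; lia.
Qed.

Lemma near_true n v : lab v != Blank -> d2 + 1 <= off v <= d2 + 1 + n ->
  off v <= d1 + d2 -> ev (near_black n) v.
Proof.
elim: n v => [|n IH] v lv ov ov'.
  by rewrite /= labelE //; case: ifP => //; lia.
have [e|ne] := eqVneq (off v) (d2 + 1); first by rewrite /= IH //; lia.
have [|p [pv lu ou]] := off_down_pos lv; first by lia.
by apply/orP; right; apply/(diaP (near_black n)); exists p => //; apply: IH => //; lia.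
Qed.

(** Here [d1 <= d2./2] matters: residue [d1 + 1] is [d1] away from 1 and [d2 - d1 >= d1] away from
    [d2 + 1]. *)
Lemma deep_at v : lab v != Blank -> off v = d1 + 1 -> ev is_deep v.
Proof.
move=> lv ov; apply/andP; split; first by rewrite /= labelE //; case: ifP => //; lia.
by apply: near_false; lia.
Qed.

Lemma to_deep_at v : lab v != Blank -> off v = d2 -> ev to_deep v.
Proof.
move=> lv ov; apply: (@wwalk_down _ _ (d1 + 1)) => //; try lia.
by move=> x; apply: deep_at.
Qed.

(** The white run above [d2 + 1] has only [d1 - 1] layers, so each of its nodes has a black node
    fewer than [d1] layers below, and a white walk cannot pass below the black layer. *)
Lemma wwalk_deep_false n v : d2 + 1 <= off v -> ~~ ev (wwalk n is_deep) v.
Proof.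
elim: n v => [|n IH] v ov; apply/negP.
  case/andP=> /= wv /negP; apply; have := whiteE wv => w.
  by apply: near_true; rewrite ?(eqP wv) //; lia.
case/andP=> [wv /(diaP (wwalk n is_deep))[p pv]]; apply/negP/IH.
by have := off_nbr_white pv wv; have := whiteE wv; lia.
Qed.

Lemma mid_at v : lab v != Blank -> off v = d2 + 1 -> ev is_mid v.
Proof.
move=> lv ov; apply/andP; split; first by rewrite /= labelE //; case: ifP => //; lia.
have [|p [pv lu ou]] := off_down_pos lv; first by lia.
by apply/(diaP to_deep); exists p => //; apply: to_deep_at => //; lia.
Qed.

Lemma wwalk_mid_false n v : d2 + 2 + n <= off v -> ~~ ev (wwalk n is_mid) v.
Proof.
elim: n v => [|n IH] v ov; apply/negP.
  case/andP=> /= /blackE b /(diaP to_deep)[p /off_nbr h]; apply/negP.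
  have ovq := off_lt v.
  have [e|ne] := eqVneq (off (nbr v p).1) 0; last first.
    by apply: wwalk_deep_false; move: h => /=; lia.
  (* Residue 0 fails the initial white test of [to_deep], present for any number of steps. *)
  rewrite /to_deep; case: (d2 - d1 - 1) => [|m]; apply/negP => /andP[] /whiteE; lia.
case/andP=> [wv /(diaP (wwalk n is_mid))[p pv]]; apply/negP/IH.
by have := off_nbr_white pv wv; have := whiteE wv; lia.
Qed.

Lemma last_at v : lab v != Blank -> off v = d1 + d2 + 1 -> ev is_last v.
Proof.
move=> lv ov; apply/andP; split; first by rewrite /= labelE //; case: ifP => //; lia.
have [|p [pv lu ou]] := off_down_pos lv; first by lia.
apply/(diaP (wwalk (d1 - 1) not_low)); exists p => //.
apply: (@wwalk_down _ _ (d2 + 1)) => //; try lia.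
move=> x lx ox; apply/andP; split; last exact: mid_not_low.
by rewrite /= labelE //; case: ifP => //; lia.
Qed.

Lemma wwalk_last_false n v : 0 < off v -> off v + n <= d2 ->
  ~~ ev (wwalk n not_low) v.
Proof.
elim: n v => [|n IH] v ov ov'; apply/negP.
  case/andP=> /= bv /negP; apply; apply: low_at1; first by rewrite (eqP bv).
  by have := blackE bv; lia.
case/andP=> [wv /(diaP (wwalk n not_low))[p pv]]; apply/negP/IH;
  by have := off_nbr_white pv wv; have := whiteE wv; lia.
Qed.

Lemma last_false v : off v <= 2 -> ~~ ev is_last v.
Proof.
move=> ov; apply/negP => /andP[/blackE b].
case/(diaP (wwalk (d1 - 1) not_low)) => p /off_nbr h; apply/negP.
have [e|ne] := boolP (0 < off (nbr v p).1 <= 2).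
  by apply: wwalk_last_false; lia.
(* Since [d1 >= 2], the walk begins with a white test, which residues 0 and [q - 1] fail. *)
have -> : d1 - 1 = (d1 - 2).+1 by lia.
apply/negP => /andP[/whiteE + _]; move: h => /=; lia.
Qed.

Lemma lower_true v : lab v != Blank -> 0 < d v -> ev (lower ((d v).+1 %% q)) v.
Proof.
move=> lv dv; rewrite offS -/(off v); have ovq := off_lt v.
case: eqP => [ov|ov]; first by apply: last_at => //; lia.
rewrite /lower /=; have [ov0|ov0] := eqVneq (off v) 0.
  rewrite ov0 /=; apply/andP; split; first exact: zero_at.
  have [p [pv _ lu ou]] := off_down lv dv.
  apply/(diaP is_last); exists p => //; apply: last_at => //.
  by move: ou; rewrite ov0; case: eqP; lia.
rewrite ifF; last by apply/eqP; lia.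
case: ifP => h1.
  apply: (@wwalk_down _ _ 1) => //; try lia.
  by move=> x; apply: low_at1.
case: ifP => h2; first by apply: to_deep_at => //; lia.
case: ifP => h3; first by rewrite /= labelE //; case: ifP => //; lia.
apply: (@wwalk_down _ _ (d2 + 1)) => //; try lia.
by move=> x; apply: mid_at.
Qed.

Lemma color_eq l : color l = color l.+1 -> l < q ->
  [|| l == 0, l == 1, l == d2 + 1 | l == d1 + d2 + 1] =
  (let l' := if l.+1 == q then 0 else l.+1 in
   [|| l' == 0, l' == 1, l' == d2 + 1 | l' == d1 + d2 + 1]).
Proof.
move=> + lq; rewrite !colorE offS modn_small //=.
by case: ifP => _; case: ifP.
Qed.

(** The case of two layers up serves the [FDia] test in [child], made only between layers of equal
    colour. *)
Lemma lower_false v l : l < q ->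
  off v = l \/ off v = l.+1 %% q \/ off v = l.+2 %% q /\ color l = color l.+1 ->
  ~~ ev (lower l) v.
Proof.
move=> lq h.
have {h} ov : off v = l \/ (l <= d1 + d2 /\ off v = l.+1) \/
    (l = d1 + d2 + 1 /\ off v <= 1) \/ (l = 0 /\ off v = 2) \/
    ((1 < l < d2 \/ d2 + 1 < l < d1 + d2) /\ off v = l.+2).
  move: h; rewrite !offS (modn_small lq) => -[->|[->|[-> /color_eq/(_ lq) /=]]].
  - by left.
  - by case: eqP lq; rewrite /q; lia.
  - move: lq; rewrite /q; have [e|e] := eqVneq l.+1 (d1 + d2 + 2); last first.
    + by have [e2|e2] := eqVneq l.+2 (d1 + d2 + 2); lia.
    + by have -> : (1 == d1 + d2 + 2) = false; lia.
rewrite /q in lq; rewrite /lower; have [l0|l0] := eqVneq l 0.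
  by apply: last_false; lia.
have [l1|l1] := eqVneq l 1.
  apply/negP => /andP[/andP[/blackE b _]].
  by apply/negP/(diaP is_last) => -[p /off_nbr h]; apply/negP/last_false; lia.
case: ifP => h2; first by apply: wwalk_low_false; lia.
case: ifP => h3; first by apply: wwalk_deep_false; lia.
case: ifP => h4; first by apply/negP => /whiteE; lia.
by apply: wwalk_mid_false; lia.
Qed.

Lemma root_lower : ~~ ev (lower 1) r.
Proof.
apply/negP => /andP[_ /(diaP is_last)[p /d_nbr[h _]]]; apply/negP/last_false.
have dr : d r = 0 by apply/eqP; rewrite d0.
by rewrite /off modn_small /q; lia.
Qed.
End Decode.

(** * Graph distance as a layering *)

Lemma bigmin_le (I : eqType) (s : seq I) (P : pred I) (F : I -> nat) n i :
  i \in s -> P i -> \big[minn/n]_(j <- s | P j) F j <= F i.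
Proof.
elim: s => // j s IH; rewrite in_cons big_cons => /orP[/eqP <- ->|/IH h /h].
  exact: geq_minl.
by case: ifP => // _; apply: leq_trans (geq_minr _ _).
Qed.

Lemma bigmin_attained (I : eqType) (s : seq I) (P : pred I) (F : I -> nat) n :
  \big[minn/n]_(j <- s | P j) F j < n ->
  exists2 i, P i & \big[minn/n]_(j <- s | P j) F j = F i.
Proof.
elim: s => [|j s IH]; first by rewrite big_nil ltnn.
rewrite big_cons; case: ifP => // Pj; rewrite /minn; case: ifP => // _ _.
by exists j.
Qed.

Section Distance.
Variables (V : finType) (deg : V -> nat) (nbr : V -> nat -> V * nat).
Hypotheses (graphP : port_graph deg nbr) (connP : connected_graph deg nbr).

Lemma adjP v u : reflect (exists2 p, p < deg v & (nbr v p).1 = u) (adj deg nbr v u).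
Proof.
apply: (iffP existsP) => [[p /eqP <-]|[p pv <-]]; first by exists p.
by exists (Ordinal pv); rewrite /= eqxx.
Qed.

Lemma adj_sym v u : adj deg nbr v u -> adj deg nbr u v.
Proof.
move=> /adjP[p pv <-]; have [h1 h2 _] := graphP pv.
by apply/adjP; exists (nbr v p).2; rewrite ?h2.
Qed.

Lemma reachn_path u p : path (adj deg nbr) u p -> reachn deg nbr (size p) u (last u p).
Proof.
elim/last_ind: p => [|p v IH] /=; first by rewrite eqxx.
rewrite rcons_path last_rcons size_rcons /= => /andP[/IH up pv].
by apply/orP; right; apply/existsP; exists (last u p); rewrite up.
Qed.

(** A path without repetition has fewer than [#|V|] edges, so the default value in [dist] is never
    taken. *)
Lemma reachn_conn u v : exists2 k, k < #|V| & reachn deg nbr k u v.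
Proof.
have /connectP[p0 /shortenP[p up uniq_p _] ->] := connP u v.
exists (size p); last exact: reachn_path.
by have := card_uniqP uniq_p => /= <-; apply: max_card.
Qed.

Lemma dist_le k u v : reachn deg nbr k u v -> k < #|V| -> dist deg nbr u v <= k.
Proof.
move=> uv kV; rewrite /dist.
exact: (bigmin_le (P := fun k : 'I__ => reachn deg nbr k u v) _ _
  (mem_index_enum (Ordinal kV))).
Qed.

Lemma dist_lt_card u v : dist deg nbr u v < #|V|.
Proof. by have [k kV /dist_le/(_ kV)/leq_ltn_trans->] := reachn_conn u v. Qed.

Lemma reachn_dist u v : reachn deg nbr (dist deg nbr u v) u v.
Proof.
have [k uv] := bigmin_attained (F := @nat_of_ord _) (dist_lt_card u v).
by rewrite /dist => ->.
Qed.

Lemma dist_min k u v : reachn deg nbr k u v -> dist deg nbr u v <= k.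
Proof.
move=> uv; have [kV|Vk] := ltnP k #|V|; first exact: dist_le.
exact: leq_trans (ltnW (dist_lt_card u v)) Vk.
Qed.

Lemma dist_eq0 u v : (dist deg nbr u v == 0) = (v == u).
Proof.
apply/eqP/eqP => [h|->]; first by have := reachn_dist u v; rewrite h /= => /eqP.
by apply/eqP; rewrite -leqn0; apply: dist_min => /=.
Qed.

Lemma dist_adj u v w : adj deg nbr v w -> dist deg nbr u w <= (dist deg nbr u v).+1.
Proof.
move=> vw; apply: dist_min; apply/orP; right; apply/existsP; exists v.
by apply/andP; split; first exact: reachn_dist.
Qed.

Lemma dist_port u v p : p < deg v ->
  dist deg nbr u (nbr v p).1 <= (dist deg nbr u v).+1 /\
  dist deg nbr u v <= (dist deg nbr u (nbr v p).1).+1.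
Proof.
move=> pv; have vw : adj deg nbr v (nbr v p).1 by apply/adjP; exists p.
by split; apply: dist_adj => //; apply: adj_sym.
Qed.

Lemma dist_down u v : 0 < dist deg nbr u v ->
  exists2 p, p < deg v & (dist deg nbr u (nbr v p).1).+1 = dist deg nbr u v.
Proof.
case E: (dist deg nbr u v) (reachn_dist u v) => [|n] //= + _.
case/orP => [/dist_min|]; first by rewrite E ltnn.
case/existsP => w /andP[/dist_min un /adj_sym/adjP[p pv pw]].
exists p => //; rewrite pw; have := dist_port u pv; rewrite pw E; lia.
Qed.
End Distance.

(** * The control program of the robot *)

Inductive mode := Start | Down | Up | Bounce.
Definition mode_code (m : mode) : bool * bool :=
  match m with Start => (true, true) | Down => (true, false)
             | Up => (false, true) | Bounce => (false, false) end.
Definition mode_decode (c : bool * bool) : mode :=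
  match c with (true, true) => Start | (true, false) => Down
             | (false, true) => Up | (false, false) => Bounce end.
Lemma mode_codeK : cancel mode_code mode_decode.
Proof. by case. Qed.
HB.instance Definition _ := Finite.copy mode (can_type mode_codeK).

Section Robot.
Variables (Delta d1 d2 : nat).
Let q := d1 + d2 + 2.

Definition hstate : finType :=
  (mode * 'I_(d1 + d2).+2 * 'I_(d1 + d2).+2 * bool * 'I_Delta.+1)%type.

(* [chg] records that the current stage has coloured a node; [bp] is the port by
   which the current neighbour of the root leads back to it. *)
Definition mk (m : mode) (l k : nat) (chg : bool) (bp : nat) : hstate :=
  (m, inord (l %% q), inord (k %% q), chg, inord bp).

(** [l + q.-1] stands for [l - 1] modulo [q]. The search fails only in layer 1, where [bp] leads
    home, and at the root, where the stage ends. *)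
Definition finish (l k bp : nat) (chg : bool) : prog hstate :=
  search (chk (lower d1 d2 l)) (fun o =>
    match o with
    | Some p => Jump p (mk Up (l + q.-1) k chg bp)
    | None => if l == 1 then Jump bp (mk Up 0 k chg bp)
              else if chg then Jump 0 (mk Bounce 0 k.+1 false 0) else Halt
    end).

(** A node beyond layer 1 is entered only if its own first lower port is the one just used, hence
    only from its tree parent. Failure of this inner search signals layer 1: a new branch begins,
    with [i] as its port home. *)
Fixpoint scan (l k bp : nat) (js : seq nat) (chg : bool) : prog hstate :=
  if js is j :: js' then
    Move j (Look (fun _ lu i =>
      if lu == Blank then
        if l == k then Write (color d1 d2 l.+1) (Move i (scan l k bp js' true))
        else Move i (scan l k bp js' chg)
      else chk (child d1 d2 l) (fun b =>
        if b then
          search (chk (lower d1 d2 (l.+1 %% q))) (fun o =>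
            Move i
              match o with
              | None => Jump j (mk Down l.+1 k chg i)
              | Some p => if p == i then Jump j (mk Down l.+1 k chg bp)
                          else scan l k bp js' chg
              end)
        else Move i (scan l k bp js' chg))))
  else finish l k bp chg.

(* Restarting at the root requires a move, so the robot first steps to a neighbour
   in mode [Bounce]. *)
Definition body (m : mode) (l k : nat) (chg : bool) (bp : nat) : prog hstate :=
  match m with
  | Start => Write Black (Look (fun d _ _ => scan 0 0 0 (iota 0 d) false))
  | Down => Look (fun d _ _ => scan l k bp (iota 0 d) chg)
  | Up => Look (fun d _ i => scan l k bp (iota i.+1 (d - i.+1)) chg)
  | Bounce => Look (fun _ _ i => Jump i (mk Down 0 k false 0))
  end.

Definition main (s : hstate) : prog hstate :=
  let '(m, l, k, chg, bp) := s in body m l k chg bp.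

Lemma main_mk m l k chg bp : bp <= Delta ->
  main (mk m l k chg bp) = body m (l %% q) (k %% q) chg bp.
Proof.
have lt n : n %% q < (d1 + d2).+2 by rewrite /q addn2 ltn_mod.
by move=> hbp; rewrite /main /mk !inordK.
Qed.

Hypotheses (d1_ge2 : 2 <= d1) (d12 : d1 <= d2./2).
Variables (V : finType) (deg : V -> nat) (nbr : V -> nat -> V * nat) (r : V).
Hypotheses (graphP : port_graph deg nbr) (connP : connected_graph deg nbr).
Hypothesis degD : forall v, deg v <= Delta.
Let d : V -> nat := dist deg nbr r.
Local Notation good := (good main deg nbr r (fun v => color d1 d2 (d v))).
Local Notation ev := (eval deg nbr).

Let d_eq0 v : (d v == 0) = (v == r). Proof. exact: dist_eq0. Qed.
Let d_nbr v p : p < deg v -> d (nbr v p).1 <= (d v).+1 /\ d v <= (d (nbr v p).1).+1.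
Proof. exact: dist_port. Qed.
Let d_down v : 0 < d v -> exists2 p, p < deg v & (d (nbr v p).1).+1 = d v.
Proof. exact: dist_down. Qed.
Let d_r : d r = 0. Proof. by apply/eqP; rewrite d_eq0. Qed.

(** * The breadth-first tree and its recognition from labels *)

Definition par_port (v : V) : option nat :=
  first_port deg nbr (fun u => (d u).+1 == d v) v.
Definition par (v : V) : V := if par_port v is Some p then (nbr v p).1 else v.

Lemma par_portP v : 0 < d v -> exists p,
  [/\ par_port v = Some p, p < deg v, par v = (nbr v p).1 & (d (par v)).+1 = d v].
Proof.
move=> /d_down[p0 hp0 dp0]; rewrite /par /par_port.
case: first_portP => [p pv /eqP dp|/(_ p0 hp0)]; first by exists p.
by rewrite dp0 eqxx.
Qed.

Lemma dist_iter_par x j : j <= d x -> d (iter j par x) = d x - j.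
Proof.
elim: j => [|j IH] hj; first by rewrite subn0.
have /par_portP[p [_ _ _]] : 0 < d (iter j par x) by rewrite IH; lia.
by rewrite iterS IH; lia.
Qed.

(* A loop at the root is traversed as if it led to a childless node of layer 1. *)
Definition at_layer (v : V) (L : nat) : Prop := d v = L \/ v = r /\ L = 1.

Lemma at_layer_le v L : at_layer v L -> d v <= L.
Proof. by case=> [->|[-> ->]]; rewrite ?d_r. Qed.

Lemma color_mod m : color d1 d2 (m %% q) = color d1 d2 m.
Proof. by rewrite /color /AL_black !modn_mod. Qed.

Lemma color_small : [/\ color d1 d2 0 = Black, color d1 d2 1 = Black
  & color d1 d2 2 = White].
Proof.
by rewrite /color /AL_black !modn_small; try lia; split=> //; rewrite ifF //; lia.
Qed.

Lemma modS m : (m %% q).+1 %% q = m.+1 %% q.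
Proof. by rewrite -addn1 modnDml addn1. Qed.

Lemma color_modS m : color d1 d2 (m %% q).+1 = color d1 d2 m.+1.
Proof. by rewrite -color_mod modS color_mod. Qed.

Section Labels.
Variable lab : V -> label.
Hypothesis labP : labeled_below d1 d2 d lab.

Let lower_true v : lab v != Blank -> 0 < d v -> ev lab (lower d1 d2 ((d v).+1 %% q)) v.
Proof. exact: lower_true. Qed.

Let lower_false v m :
  d v = m \/ d v = m.+1 \/ d v = m.+2 /\ color d1 d2 m = color d1 d2 m.+1 ->
  ~~ ev lab (lower d1 d2 (m %% q)) v.
Proof.
move=> h; apply: (lower_false d1_ge2 d12 d_nbr d_down labP).
  by rewrite ltn_mod /q addn2.
rewrite /off; case: h => [->|[->|[-> e]]]; [by left|right; left|right; right].
  by rewrite -/q modS.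
split; last by rewrite color_modS color_mod.
by rewrite -/q -(modS (m %% q).+1) (modS m) modS.
Qed.

(** By [1 < d v] the root is not a parent candidate, so exactly the neighbours one layer down
    satisfy the formula. *)
Lemma lower_port v : lab v != Blank -> 1 < d v ->
  first_port deg nbr (ev lab (lower d1 d2 (d v %% q))) v = par_port v.
Proof.
move=> lv dv; apply: eq_first_port => p pv.
have [h1 h2] := d_nbr pv; case: eqP => [e|e].
  have [_ h] := labP lv; rewrite -e lower_true //; last by lia.
  by apply: h; rewrite -e.
by apply/negbTE/lower_false; lia.
Qed.

Lemma lower_port_none v L : L <= 1 -> d v <= L ->
  first_port deg nbr (ev lab (lower d1 d2 L)) v = None.
Proof.
move=> L1 dv; case: first_portP => // p pv; have [h1 h2] := d_nbr pv.
have [e|e] := eqVneq (d (nbr v p).1).+1 L.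
  have -> : (nbr v p).1 = r by apply/eqP; rewrite -d_eq0; lia.
  have -> : L = 1 by lia.
  by rewrite (negPf (root_lower d1_ge2 d12 d_eq0 d_nbr d_down labP)).
have := @lower_false (nbr v p).1 L; rewrite modn_small; last by rewrite /q; lia.
by move=> /(_ ltac:(lia))/negPf->.
Qed.

(** Layer [L - 1] is excluded by [lower]. Layer [L] is excluded by the label if the colours differ;
    otherwise such a node is betrayed by its own neighbour one layer down, which a node of layer
    [L + 1] lacks. *)
Lemma childP v p L : lab v != Blank -> at_layer v L -> p < deg v ->
  let u := (nbr v p).1 in
  reflect (lab u != Blank /\ at_layer u L.+1) (ev lab (child d1 d2 (L %% q)) u).
Proof.
move=> lv vL pv; set u := (nbr v p).1 => /=; have [uv vu] := d_nbr pv.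
rewrite -/u in uv vu; have [c0 c1 c2] := color_small.
have -> : ev lab (child d1 d2 (L %% q)) u =
  [&& lab u == color d1 d2 L.+1, ~~ ev lab (lower d1 d2 (L %% q)) u &
    (color d1 d2 L == color d1 d2 L.+1) ==> ~~ ev lab (FDia (lower d1 d2 (L %% q))) u].
  by rewrite /child color_modS color_mod; case: eqP => _; rewrite /= ?andbT ?andbA.
apply: (iffP and3P) => [[/eqP lu nlow /implyP nDia]|[lu uL]].
  have nu : lab u != Blank by rewrite lu /color; case: ifP.
  split=> //; have [cu _] := labP nu; rewrite lu in cu.
  case: vL => [vL|[vr L1]]; last first.
    move: cu; rewrite L1 c2; have : d u <= 1 by rewrite vr d_r in uv.
    by case: (d u) => [|[|]] //; rewrite ?c0 ?c1.
  rewrite vL in uv vu; have [e|ne] := eqVneq (d u) L.+1; first by left.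
  have [e|ne'] := eqVneq (d u).+1 L.
    have [du|du] := posnP (d u).
      (* [lower] misses the root, but then [L = 1], and the root is black while layer 2 is white. *)
      by move: cu; rewrite -e du c0 c2.
    by rewrite -e lower_true in nlow.
  have e : d u = L by lia.
  have [L0|L0] := posnP L.
    by right; rewrite L0; split=> //; apply/eqP; rewrite -d_eq0 e L0.
  have [|x [xu ex lx _]] := off_down d1_ge2 d12 d_down labP nu; first by rewrite e.
  have [dx|dx] := posnP (d (nbr u x).1); first by move: cu; rewrite e -e -ex dx c1 c2.
  have /negP[] := nDia ltac:(by rewrite cu e).
  by apply/evalDiaP; exists x => //; rewrite -e -ex lower_true.
split.
- case: uL => [e|[e [->]]]; first by have [-> _] := labP lu; rewrite e.
  by have [-> _] := labP lu; rewrite e d_r c0 c1.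
- by apply: lower_false; case: uL => [->|[-> [->]]]; [right; left | rewrite d_r; left].
- apply/implyP => /eqP cc; apply/negP => /evalDiaP[x /d_nbr[h1 h2]].
  have : d (nbr u x).1 = L \/ d (nbr u x).1 = L.+1 \/ d (nbr u x).1 = L.+2.
    by case: uL => [e|[e [L0]]]; [lia | rewrite e d_r in h1 *; lia].
  by move=> h; apply/negP/lower_false; case: h => [|[]]; auto.
Qed.
End Labels.

(** * One stage of the traversal *)

Definition staged (k : nat) (lab : V -> label) : Prop := forall v,
  [/\ lab v != Blank -> lab v = color d1 d2 (d v), d v <= k -> lab v != Blank
    & k.+1 < d v -> lab v = Blank].

Lemma staged_below k lab : staged k lab -> labeled_below d1 d2 d lab.
Proof.
move=> h v lv; have [h1 h2 h3] := h v; split; first exact: h1.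
move=> w wv; have [_ + _] := h w; apply.
have [dv|/h3 e] := leqP (d v) k.+1; first by lia.
by rewrite e in lv.
Qed.

Section Stage.
Variable k : nat.

(* The descendants of [v] in layer [k] have no blank neighbour left. *)
Definition covered (v : V) (L : nat) (lab : V -> label) : Prop :=
  forall x, d x = k -> L <= k -> iter (k - L) par x = v ->
  forall p, p < deg x -> lab (nbr x p).1 != Blank.

(** The last two clauses drive termination: a raised flag proves that layer [k + 1] is nonempty, and
    a lowered one that the stage changed no label. *)
Definition extends (lab : V -> label) (chg : bool) (lab' : V -> label) (chg' : bool) :=
  [/\ staged k lab', forall w, lab w != Blank -> lab' w != Blank,
      chg' -> chg \/ exists w, d w = k.+1
    & ~~ chg' -> ~~ chg /\ lab' =1 lab].

Lemma extends_trans lab1 c1 lab2 c2 lab3 c3 :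
  extends lab1 c1 lab2 c2 -> extends lab2 c2 lab3 c3 -> extends lab1 c1 lab3 c3.
Proof.
move=> [s1 m1 a1 b1] [s2 m2 a2 b2]; split=> //.
- by move=> w /m1/m2.
- by move=> /a2[/a1|]; [|right].
- by move=> /b2[/b1[nc1 e1] e2]; split=> // w; rewrite e2.
Qed.

Lemma covered_mono v L lab lab' : (forall w, lab w != Blank -> lab' w != Blank) ->
  covered v L lab -> covered v L lab'.
Proof. by move=> h c x dx Lk ix p px; apply: h; apply: (c x). Qed.

(** A Hoare triple in continuation form: success after leaving through [p0] with the subtree covered
    gives success from the arrival at [v]. *)
Definition visit_spec (L : nat) : Prop := forall v i lab chg bp p0,
  at_layer v L -> staged k lab -> lab v != Blank -> bp <= Delta ->
  p0 < deg v -> (if L == 1 then p0 = bp else par_port v = Some p0) ->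
  (forall lab' chg', extends lab chg lab' chg' -> covered v L lab' ->
     good (main (mk Up L.-1 k chg' bp)) (nbr v p0).1 (nbr v p0).2 lab') ->
  good (main (mk Down L k chg bp)) v i lab.

Definition port_done (v : V) (L p : nat) (lab : V -> label) : Prop :=
  let u := (nbr v p).1 in
  (L = k -> lab u != Blank) /\
  (L < k -> at_layer u L.+1 -> L = 0 \/ par_port u = Some (nbr v p).2 ->
   covered u L.+1 lab).

(** The ancestor [y] of [x] in layer [L + 1] is joined to [v] by its parent edge, so the port of [v]
    on that edge accounts for [x]. *)
Lemma ports_covered v L lab :
  (forall p, p < deg v -> port_done v L p lab) -> covered v L lab.
Proof.
move=> hv x dx; rewrite leq_eqVlt => /predU1P[e|Lk ix].
  by rewrite e subnn /= => -> p pv; have [h _] := hv p pv; apply: h.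
pose y := iter (k - L.+1) par x.
have dy : d y = L.+1 by rewrite /y dist_iter_par; lia.
have [py [hpy pyy epy dpy]] : exists p, _ := par_portP (ltac:(by rewrite dy) : 0 < d y).
have ey : par y = v by rewrite -ix /y -iterS -subSn ?subSS.
have [h1 h2 _] := graphP pyy.
rewrite -epy ey in h1 h2.
have [_ h] := hv _ h1; rewrite h2 /= in h.
by apply: (h Lk) => //; [left | right].
Qed.

Lemma extends_refl lab chg : staged k lab -> extends lab chg lab chg.
Proof. by move=> st; split=> //; left. Qed.

Lemma port_done_mono v L p lab lab' : (forall w, lab w != Blank -> lab' w != Blank) ->
  port_done v L p lab -> port_done v L p lab'.
Proof.
move=> h [d_k d_lt]; split=> [/d_k/h //|Lk uL e].
exact: (covered_mono h (d_lt Lk uL e)).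
Qed.

Lemma mk_down L chg bp : mk Down (L %% q).+1 (k %% q) chg bp = mk Down L.+1 k chg bp.
Proof. by rewrite /mk modS modn_mod. Qed.

Lemma mk_up L chg bp : 0 < L ->
  mk Up (L %% q + q.-1) (k %% q) chg bp = mk Up L.-1 k chg bp.
Proof.
move=> L0; rewrite /mk modnDml modn_mod.
by have -> : L + q.-1 = L.-1 + q; [rewrite /q; lia | rewrite modnDr].
Qed.

Lemma staged_color lab u : staged k lab -> lab u = Blank -> d u = k.+1 ->
  extends lab true (upd lab u (color d1 d2 k.+1)) true.
Proof.
move=> st lu du; split=> //.
- move=> w; rewrite /upd; case: (w =P u) => [->|_]; last exact: st.
  by rewrite du; split=> //; [rewrite /color; case: ifP | rewrite ltnn].
- by move=> w lw; rewrite /upd; case: (w =P u) => // _; rewrite /color; case: ifP.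
- by move=> _; left.
Qed.

(** Induction on the [m] unscanned ports, with the invariant that those below [j] are done. Only at
    the root may [bp] change, as each branch brings its own. *)
Lemma scan_good L v lab0 chg0 bp0 : L <= k.+1 -> (L <= k -> visit_spec L.+1) ->
  at_layer v L -> lab0 v != Blank ->
  (forall lab' chg' bp' i', extends lab0 chg0 lab' chg' -> covered v L lab' ->
     (0 < L -> bp' = bp0) -> bp' <= Delta ->
     good (finish (L %% q) (k %% q) bp' chg') v i' lab') ->
  forall m j lab chg bp i, j + m = deg v -> (0 < L -> bp = bp0) -> bp <= Delta ->
  extends lab0 chg0 lab chg -> (forall p, p < j -> port_done v L p lab) ->
  good (scan (L %% q) (k %% q) bp (iota j m) chg) v i lab.
Proof.
move=> Lk IHv vL lv0 fin; elim=> [|m IH] j lab chg bp i jm hbp bpD ext before.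
  apply: fin => //; apply: ports_covered => p pv.
  by apply: before; rewrite addn0 in jm; rewrite jm.
have pv : j < deg v by lia.
have [u1 u2 _] := graphP pv.
have [st mono _ _] := ext; have lb := staged_below st; have lv := mono _ lv0.
have [h1 h2] := d_nbr pv; have dvL := at_layer_le vL.
apply: GMove => //; apply: GLook.
set u := (nbr v j).1 in u1 u2 h1 h2 *; set i' := (nbr v j).2 in u1 u2 *.
have next lab' chg' bp' i1 : extends lab chg lab' chg' -> port_done v L j lab' ->
    (0 < L -> bp' = bp0) -> bp' <= Delta ->
    good (scan (L %% q) (k %% q) bp' (iota j.+1 m) chg') v i1 lab'.
  move=> ext' dj hb hD; have [_ mono' _ _] := ext'.
  apply: IH => //; [by lia | exact: extends_trans ext ext' |].
  move=> p; rewrite ltnS leq_eqVlt => /predU1P[-> //|/before].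
  exact: port_done_mono.
have back P i1 lab' : good P v j lab' -> good (Move i' P) u i1 lab'.
  by move=> h; apply: GMove => //; rewrite u2.
case: eqP => lu.
  have du : k < d u.
    by rewrite ltnNge; apply/negP; have [_ h _] := st u => /h; rewrite lu.
  have dj lab' : lab' u != Blank \/ L <> k -> port_done v L j lab'.
    by move=> h; split=> [e|Lk']; [case: h | lia].
  case: eqP => e.
    (* The robot compares residues only; a blank neighbour leaves [k] and [k + 1] for [L], and
       consecutive residues differ. *)
    have Lk' : L = k.
      have [e'|//] : L = k.+1 \/ L = k by lia.
      move: e; rewrite e' (offS d1_ge2 d12) -/q; move: (k %% q) => x.
      by case: ifP => /eqP; rewrite /q; lia.
    apply: GWrite; apply: back; apply: next => //; last first.
      by apply: dj; left; rewrite /upd eqxx /color; case: ifP.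
    rewrite color_modS Lk'; apply: extends_trans (staged_color st lu _); last by lia.
    split=> //; move=> _; right; exists u; lia.
  apply: back; apply: next => //; first exact: extends_refl.
  by apply: dj; right => Lk'; rewrite Lk' in e.
move/eqP: lu => lu; apply: (good_chk graphP) => i1.
case: (childP lb lv vL pv) => [[_ uL]|nch]; last first.
  apply: back; apply: next => //; first exact: extends_refl.
  by split=> // Lk' uL; case: nch.
(* No descent from layer [k + 1]: layer [k + 2] is still blank. *)
have Lk' : L <= k.
  rewrite leqNgt; apply/negP => kL; case: uL => [du|[_ L0]]; last by lia.
  by have [_ _ h] := st u; move: lu; rewrite h // /u du ltnS.
have desc bp' i2 : (0 < L -> bp' = bp0) -> bp' <= Delta ->
    (if L.+1 == 1 then i' = bp' else par_port u = Some i') ->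
    good (Move i' (Jump j (mk Down (L %% q).+1 (k %% q) chg bp'))) u i2 lab.
  move=> hb hD hi; apply: back; apply: GJump => //; rewrite mk_down.
  apply: (IHv Lk') hi _ => // lab' chg' ext' cov'.
  rewrite u2 main_mk //=; apply: GLook; have -> : deg v - j.+1 = m by lia.
  apply: next => //; have [_ mono' _ _] := ext'.
  by split=> // _; apply: mono'.
apply: (good_search (a := ev lab (lower d1 d2 ((L %% q).+1 %% q))) graphP).
  by move=> w i2 k' hk; apply: (good_chk graphP).
move=> i2; rewrite modS; have [L0|L0] := posnP L.
  rewrite L0 modn_small; last by rewrite /q; lia.
  rewrite lower_port_none //; last by have := at_layer_le uL; rewrite L0.
  rewrite -L0; apply: desc; rewrite ?L0 //.
  by have := degD u; lia.
have du : d u = L.+1 by case: uL => // -[_ ]; lia.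
rewrite -du lower_port //; last by rewrite du.
have [p [hp _ _ _]] : exists p, _ := par_portP (ltac:(by rewrite du) : 0 < d u).
rewrite hp; case: eqP => [e|ne].
  by apply: desc => //; rewrite -e hp; case: eqP => // -[]; lia.
apply: back; apply: next => //; first exact: extends_refl.
by split=> // Lk2 _ [|[]]; [lia | rewrite -/u hp => -[]].
Qed.

Lemma visit L : 0 < L -> L <= k.+1 -> visit_spec L.
Proof.
have [n] := ubnP (k.+1 - L); elim: n L => // n IH L hn L0 Lk.
move=> v i lab chg bp p0 vL st lv bpD pv hp0 K.
rewrite main_mk //; apply: GLook.
apply: (@scan_good L v lab chg bp) => //; last exact: extends_refl.
  by move=> Lk'; apply: IH; lia.
move=> lab' chg' bp' i' ext cov /(_ L0) -> _.
have [st' mono _ _] := ext; have lb := staged_below st'.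
apply: (good_search (a := ev lab' (lower d1 d2 (L %% q))) graphP).
  by move=> w i2 k' hk; apply: (good_chk graphP).
move=> i2; move: hp0; have [L1|L1] := eqVneq L 1.
  move=> e; rewrite -e in K *; have -> : L %% q = 1 by rewrite L1 modn_small // /q; lia.
  rewrite lower_port_none //; last by have := at_layer_le vL; rewrite L1.
  apply: GJump => //; move: K; rewrite L1 /= => K.
  by rewrite /mk modn_mod; apply: K => //; rewrite -L1.
have dv : d v = L by case: vL => // -[_ /eqP]; rewrite (negPf L1).
move=> e; rewrite -dv lower_port //; [|exact: mono|by lia].
by rewrite e dv; apply: GJump => //; rewrite mk_up //; apply: K.
Qed.
End Stage.

(** * Iterating the stages *)

Lemma deg_root w : 0 < d w -> 0 < deg r.
Proof.
move=> dw; have d1w : d (iter (d w).-1 par w) = 1 by rewrite dist_iter_par; lia.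
have /par_portP[p [_ pw pe dp]] : 0 < d (iter (d w).-1 par w) by rewrite d1w.
have [h _ _] := graphP pw; rewrite -pe in h.
have e : par (iter (d w).-1 par w) = r by apply/eqP; rewrite -d_eq0; lia.
by rewrite e in h; lia.
Qed.

(** Induction on [#|V| - k]: a stage that colours something exhibits a node at distance [k + 1], so
    [k + 1 < #|V|]. *)
Lemma root_good k lab i bp : k < #|V| -> staged k lab ->
  (forall w, d w = k.+1 -> lab w = Blank) -> bp <= Delta ->
  good (scan 0 (k %% q) bp (iota 0 (deg r)) false) r i lab.
Proof.
have [n] := ubnP (#|V| - k).
elim: n k lab i bp => // n IH k lab i bp kn kV st bl bpD.
have lr : lab r != Blank by have [_ h _] := st r; apply: h; rewrite d_r.
have := @scan_good k 0 r lab false bp; rewrite mod0n; apply=> //.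
- by move=> _; apply: visit.
- by left.
move=> lab' chg' bp' i' ext cov _ bpD'; have [st' mono h1 h2] := ext.
have full w : d w = k.+1 -> lab' w != Blank.
  move=> dw; have /par_portP[p [_ pw pe dp]] : 0 < d w by rewrite dw.
  have [u1 u2 _] := graphP pw; rewrite -pe in u1 u2.
  have := cov (par w) _ _ _ _ u1; rewrite u2; apply=> //; first by lia.
  by apply/eqP; rewrite -d_eq0 dist_iter_par; lia.
apply: (good_search (a := ev lab' (lower d1 d2 0)) graphP).
  by move=> w i2 k' hk; apply: (good_chk graphP).
move=> i2; rewrite (lower_port_none (staged_below st')) ?d_r //=.
case: chg' h1 h2 ext => [/(_ isT)[//|[w dw]] _|_ /(_ isT)[_ e]] ext.
  (* Port 0, used for the bounce, exists since some node differs from the root. *)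
  have r0 : 0 < deg r by apply: (@deg_root w); rewrite dw.
  have [u1 u2 _] := graphP r0.
  apply: GJump => //; rewrite main_mk //; apply: GLook; apply: GJump => //; rewrite u2.
  rewrite main_mk //; apply: GLook; rewrite mod0n modn_mod modS.
  have := dist_lt_card connP r w; rewrite -/d dw => kV'.
  apply: IH => //; first by lia.
    move=> x; have [a1 a2 a3] := st' x; split=> //; last by move=> ?; apply: a3; lia.
    by rewrite leq_eqVlt => /predU1P[/full|].
  by move=> x dx; have [_ _ h] := st' x; apply: h; lia.
apply: GHalt => w; have [a1 _ _] := st' w; apply: a1.
have [_ h _] := st' w; apply: h; rewrite leqNgt; apply/negP => kw.
(* An unlabelled [w] would have an ancestor in layer [k + 1], labelled by [full] yet blank since the
   stage changed nothing. *)
have dy : d (iter (d w - k.+1) par w) = k.+1 by rewrite dist_iter_par; lia.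
by have := full _ dy; rewrite e bl.
Qed.

Lemma start_good : good (main (mk Start 0 0 false 0)) r 0 (fun=> Blank).
Proof.
rewrite main_mk //; apply: GWrite; apply: GLook => /=.
have := @root_good 0 (upd (fun=> Blank) r Black) 0 0; rewrite mod0n; apply=> //.
- by apply/card_gt0P; exists r.
- move=> v; rewrite /upd; case: (v =P r) => [->|/eqP vr]; split=> //.
  + by rewrite d_r; have [] := color_small.
  + by rewrite d_r.
  by rewrite leqn0 d_eq0 (negPf vr).
- by move=> w dw; rewrite /upd; case: (w =P r) => // e; rewrite e d_r in dw.
Qed.
End Robot.

Theorem theorem2 (Delta d1 d2 : nat) :
  2 <= d1 -> d1 <= d2./2 ->
  exists (S : finType) (s0 : S) (delta : transition S),
    forall (V : finType) (deg : V -> nat) (nbr : V -> nat -> V * nat) (r : V),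
      port_graph deg nbr ->
      connected_graph deg nbr ->
      (forall v, deg v <= Delta) ->
      d1 + d2 + 1 <= diameter deg nbr ->
      exists n : nat,
        let c := run deg nbr delta s0 r n in
        [/\ st_status c = Halted,
            st_node c = r,
            st_visited c = [set: V]
          & forall v : V, st_labels c v = AL_color deg nbr r d1 d2 v].
Proof.
move=> d1_ge2 d12.
exists (@rstate Delta _ (@main Delta d1 d2)).
exists (mk Delta d1 d2 Start 0 0 false 0, [bseq]).
exists (@compile Delta _ (@main Delta d1 d2)) => V deg nbr r graphP connP degD _.
have [|n hn] := compile_correct graphP degD (start_good d1_ge2 d12 r graphP connP degD).
  by move=> w; rewrite /color; case: ifP.
by exists n.
Qed.
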